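(* Let $\mu\in(0,1)$ and $\epsilon\in(0,1)$, and let $V(N,\rho)$ be the value function of the malicious expert against the multiplicative weights algorithm with parameter $\epsilon$, with horizon $N$ and initial weight $\rho$ of the malicious expert (as defined in the context). Then $$\limsup_{N\to\infty}\frac{V(N,1/2)}{N}\le 1-\mu^2 .$$
   Context: Prediction game. There are two experts and a forecaster. At each round $t=1,2,\dots$ the true outcome is $y_t\in\{0,1\}$, expert $i\in\{1,2\}$ predicts $x_t^i\in\{0,1\}$, and expert $i$ has weight $p_t^i\ge 0$ with $p_t^1+p_t^2=1$. The forecaster predicts $\hat y_t=p_t^1x_t^1+p_t^2x_t^2$ and suffers the loss $l(\hat y_t,y_t)=|\hat y_t-y_t|$. The multiplicative weights algorithm with parameter $\epsilon\in(0,1)$ updates $$p_{t+1}^i=\frac{p_t^i\,\epsilon^{|x_t^i-y_t|}}{p_t^1\epsilon^{|x_t^1-y_t|}+p_t^2\epsilon^{|x_t^2-y_t|}},\quad i=1,2.$$ Let $\mathcal G_t=\{p_l^1,p_l^2,x_l^1,x_l^2,y_l: l=1,\dots,t-1\}\cup\{p_t^1,p_t^2\}$ be the history before round $t$. Expert 2 is honest: at each round, independently of $\mathcal G_t$ (and of expert 1's choice at that round), $x_t^2=y_t$ with probability $\mu$ and $x_t^2=1-y_t$ with probability $1-\mu$. Expert 1 is malicious: at each round he chooses, as a function $\alpha_t$ of $\mathcal G_t$, an action in $\{T,L\}$, where $T$ (truth) means $x_t^1=y_t$ and $L$ (lie) means $x_t^1=1-y_t$. A strategy is a sequence $\alpha=(\alpha_1,\alpha_2,\dots)$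 of such functions. Consequently the loss at round $t$ is $p_t^1$ if $\alpha_t=L,\ x_t^2=y_t$; $1$ if $\alpha_t=L,\ x_t^2=1-y_t$; $0$ if $\alpha_t=T,\ x_t^2=y_t$; and $1-p_t^1$ if $\alpha_t=T,\ x_t^2=1-y_t$. The weight evolves by $p_{t+1}^1=g(p_t^1)$ if $\alpha_t=L,\ x_t^2=y_t$; $p_{t+1}^1=g^{(-1)}(p_t^1)$ if $\alpha_t=T,\ x_t^2=1-y_t$; and $p_{t+1}^1=p_t^1$ otherwise, where $$g(p)=\frac{1}{1+(1/p-1)/\epsilon},\qquad g^{(-1)}(p)=\frac{1}{1+(1/p-1)\epsilon}.$$ The value function is $$V(N,\rho)=\max_{\alpha}\mathbb E^{\alpha}\Big[\sum_{t=1}^N l(\hat y_t,y_t)\,\Big|\,p_1^1=\rho\Big],$$ the maximum being over all strategies $\alpha$ of the malicious expert. *)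

(* Defs.v *)
From HB Require Import structures.
From mathcomp Require Import all_boot all_order all_algebra.
From mathcomp Require Import all_classical all_reals all_analysis.

Set Implicit Arguments.
Unset Strict Implicit.
Unset Printing Implicit Defensive.

Import Order.TTheory GRing.Theory Num.Theory.
Import numFieldNormedType.Exports.

Local Open Scope classical_set_scope.
Local Open Scope ring_scope.

(* Outcomes and predictions in {0, 1} are booleans, read as reals through
   [b%:R].  Rounds are numbered from 0, so index [t] is round [t + 1] of the
   game. A pair [p : R * R] holds the weights of the two experts. *)

Inductive action := Truth | Lie.

(* What is recorded of one past round: the weights used, the predictions of
   both experts and the outcome. *)
Record round (R : realType) := Round {
  round_weights : R * R;
  round_x1 : bool;
  round_x2 : bool;
  round_y : bool }.

(* A value of the history before a round: the past rounds in chronological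
   order, and the current weights. *)
Definition history (R : realType) : Type := (seq (round R) * (R * R))%type.

Definition strategy (R : realType) : Type := nat -> history R -> action.

Definition predict1 (a : action) (y : bool) : bool :=
  if a is Truth then y else ~~ y.

(* The exponent [x (+) y] is |x - y| for x, y in {0, 1}. *)
Definition mw_update (R : realType) (eps : R) (p : R * R) (x1 x2 y : bool) :
    R * R :=
  let w1 := p.1 * eps ^+ (x1 (+) y) in
  let w2 := p.2 * eps ^+ (x2 (+) y) in
  (w1 / (w1 + w2), w2 / (w1 + w2)).

Definition forecast (R : realType) (p : R * R) (x1 x2 : bool) : R :=
  p.1 * x1%:R + p.2 * x2%:R.

Definition loss (R : realType) (yhat : R) (y : bool) : R := `|yhat - y%:R|.

(* [hist_before eps y x2 a rho t w] is the history (G_t) before round [t] along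
   the sample point [w], when expert 1 starts from weight [rho] and follows the
   strategy [a]; [y] and [x2] are the processes of outcomes and of predictions
   of expert 2. *)
Fixpoint hist_before (R : realType) (Om : Type) (eps : R)
    (y x2 : nat -> Om -> bool) (a : strategy R) (rho : R) (t : nat) (w : Om) :
    history R :=
  if t is s.+1 then
    let h := hist_before eps y x2 a rho s w in
    let x1 := predict1 (a s h) (y s w) in
    (rcons h.1 (Round h.2 x1 (x2 s w) (y s w)),
     mw_update eps h.2 x1 (x2 s w) (y s w))
  else ([::], (rho, 1 - rho)).

Definition round_loss (R : realType) (Om : Type) (eps : R)
    (y x2 : nat -> Om -> bool) (a : strategy R) (rho : R) (t : nat) (w : Om) :
    R :=
  let h := hist_before eps y x2 a rho t w in
  loss (forecast h.2 (predict1 (a t h) (y t w)) (x2 t w)) (y t w).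

Definition total_loss (R : realType) (Om : Type) (eps : R)
    (y x2 : nat -> Om -> bool) (a : strategy R) (rho : R) (N : nat) (w : Om) :
    R :=
  \sum_(t < N) round_loss eps y x2 a rho t w.

(* Under [P], at each round expert 2 is right with probability [mu],
   independently of the history.  The history takes finitely many values, so
   the preimages below are exactly the events of the sigma-algebra it
   generates; they include those describing the action of expert 1 at round
   [t].  Nothing is assumed on the law of the outcomes. *)
Definition honest_expert (R : realType) (d : measure_display)
    (Om : measurableType d) (mu eps : R) (y x2 : nat -> {mfun Om >-> bool})
    (a : strategy R) (rho : R) (P : probability Om R) : Prop :=
  forall (t : nat) (H : set (history R)),
    let correct := [set w | x2 t w = y t w] in
    P correct = mu%:E /\
    P (hist_before eps (fun s => y s) (fun s => x2 s) a rho t @^-1` H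
         `&` correct)
      = (P (hist_before eps (fun s => y s) (fun s => x2 s) a rho t @^-1` H)
         * P correct)%E.

(* [Pr rho a] is the law of the game given that the initial weight of expert 1
   is [rho], when he follows the strategy [a]: the expectation under [Pr rho a]
   is E^a[ . | p_1^1 = rho].  When expert 2 is honest under every [Pr rho a],
   the supremum is a maximum, attained by a strategy obtained by backward
   induction. *)
Definition value (R : realType) (d : measure_display) (Om : measurableType d)
    (eps : R) (y x2 : nat -> {mfun Om >-> bool})
    (Pr : R -> strategy R -> probability Om R) (N : nat) (rho : R) : \bar R :=
  ereal_sup
    [set 'E_(Pr rho a)[total_loss eps (fun t => y t) (fun t => x2 t) a rho N]%E
      | a in [set: strategy R]].

(* Main.v *)
(* Let r be the odds p^1 / p^2 of expert 1, so that a lie against a correct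
   expert 2 multiplies r by eps, and a truth against a wrong one divides it by
   eps.  With phi(r) = max(0, r / (1 + r) - (1 - mu)), the potential
   sum_j phi(r eps^j) pays for the stretches where expert 1 has a large weight:
   whatever the action, one round's expected loss plus the expected change of
   the potential is at most 1 - mu^2.  For r = 1 only boundedly many terms of the
   sum are nonzero, so V(N, 1/2) <= N (1 - mu^2) + O(1).  Truncating the sum
   after a number of terms that exceeds the horizon by a constant keeps it finite
   and does not affect the bound, as r <= eps^-t before round t. *)
Require Import Defs.
From HB Require Import structures.
From mathcomp Require Import all_boot all_order all_algebra.
From mathcomp Require Import all_classical all_reals all_analysis.
From mathcomp Require Import ring lra measurable_realfun.

Set Implicit Arguments.
Unset Strict Implicit.
Unset Printing Implicit Defensive.

Import Order.TTheory GRing.Theory Num.Theory.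
Import numFieldNormedType.Exports.

Local Open Scope classical_set_scope.
Local Open Scope ring_scope.

(** * The potential of the odds *)

(** A lie at weight p costs mu p + 1 - mu in expectation, which exceeds 1 - mu^2 exactly when p > 1
    - mu (for mu > 0); hence this threshold. *)
Definition excess (R : realType) (mu r : R) : R :=
  Num.max 0 (r / (1 + r) - (1 - mu)).

Definition potential (R : realType) (mu eps : R) (M : nat) (r : R) : R :=
  \sum_(j < M) excess mu (r * eps ^+ j).

Lemma excess_ge0 (R : realType) (mu r : R) : 0 <= excess mu r.
Proof. by rewrite /excess le_max lexx. Qed.

Lemma le_excess (R : realType) (mu r : R) :
  r / (1 + r) <= 1 - mu + excess mu r.
Proof. by rewrite -lerBlDl /excess le_max lexx orbT. Qed.

Lemma excess_le (R : realType) (mu r : R) :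
  0 <= mu -> 0 <= r -> excess mu r <= mu.
Proof.
move=> mu0 r0; rewrite /excess ge_max mu0/=.
have : r / (1 + r) <= 1 by rewrite ler_pdivrMr ?mul1r; lra.
lra.
Qed.

Lemma excess_eq0 (R : realType) (mu r : R) :
  0 <= r -> r * mu <= 1 - mu -> excess mu r = 0.
Proof.
move=> r0 rmu; apply/max_idPl; rewrite subr_le0 ler_pdivrMr; nra.
Qed.

Lemma potential_ge0 (R : realType) (mu eps : R) (M : nat) (r : R) :
  0 <= potential mu eps M r.
Proof. by apply: sumr_ge0 => j _; exact: excess_ge0. Qed.

(** Multiplying the odds by [eps] shifts the sum by one index: the first term leaves and a boundary
    term of index [M] enters. *)
Lemma potentialM (R : realType) (mu eps : R) (M : nat) (r : R) :
  potential mu eps M (r * eps)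
  = potential mu eps M r - excess mu r + excess mu (r * eps ^+ M).
Proof.
(* The sum of [M.+1] terms is split once at its first term and once at its last. *)
have := erefl (potential mu eps M.+1 r).
rewrite {1}/potential big_ord_recl /= expr0 mulr1 /potential big_ord_recr /=.
under eq_bigr do rewrite /bump /= exprS mulrA.
lra.
Qed.

(** Terms of index at least [K] vanish, and each of the first [K] is at most [mu <= 1]. The bound
    does not depend on [n]. *)
Lemma potential_le (R : realType) (mu eps : R) (K n : nat) (r : R) :
    0 <= mu <= 1 -> 0 <= eps <= 1 -> 0 <= r -> r * eps ^+ K * mu <= 1 - mu ->
  potential mu eps (K + n) r <= K%:R.
Proof.
move=> /andP[mu0 mu1] /andP[e0 e1] r0 hK; rewrite /potential big_split_ord /=.
rewrite [X in _ + X]big1 ?addr0 => [|j _]; last first.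
  apply: excess_eq0; first by rewrite mulr_ge0 ?exprn_ge0.
  apply: le_trans hK; rewrite exprD mulrA.
  apply: ler_wpM2r => //; apply: ler_piMr; last exact: exprn_ile1.
  by rewrite mulr_ge0 ?exprn_ge0.
have -> : K%:R = \sum_(j < K) (1 : R) by rewrite sumr_const card_ord.
apply: ler_sum => j _; apply: (le_trans _ mu1); apply: excess_le => //.
by rewrite mulr_ge0 ?exprn_ge0.
Qed.

(** * Evolution of the odds *)

Definition odds (R : realType) (p : R * R) : R := p.1 / p.2.

(** Invariant of the weights after [t] updates from odds at most 1. *)
Definition weights_after (R : realType) (eps : R) (t : nat) (p : R * R) : Prop :=
  [/\ 0 < p.1, 0 < p.2, p.1 + p.2 = 1 & odds p * eps ^+ t <= 1].

Lemma odds_gt0 (R : realType) (eps : R) (t : nat) (p : R * R) :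
  weights_after eps t p -> 0 < odds p.
Proof. by case=> p1 p2 _ _; rewrite /odds divr_gt0. Qed.

Lemma odds_ratio (R : realType) (eps : R) (t : nat) (p : R * R) :
  weights_after eps t p -> odds p / (1 + odds p) = p.1.
Proof.
case=> p1 p2 p12 _; rewrite /odds.
have p2N0 : p.2 != 0 by rewrite gt_eqF.
have -> : 1 + p.1 / p.2 = p.2^-1.
  by rewrite -{1}(divff p2N0) -mulrDl addrC p12 mul1r.
by rewrite invrK divfK.
Qed.

Lemma odds_update (R : realType) (eps : R) (t : nat) (p : R * R)
    (x1 x2 y : bool) : 0 < eps -> weights_after eps t p ->
  odds (mw_update eps p x1 x2 y)
  = odds p * eps ^+ (x1 (+) y) / eps ^+ (x2 (+) y).
Proof.
move=> e0 [p1 p2 p12 _]; rewrite /odds /mw_update /=.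
have w1 : 0 < p.1 * eps ^+ (x1 (+) y) by rewrite mulr_gt0 ?exprn_gt0.
have w2 : 0 < p.2 * eps ^+ (x2 (+) y) by rewrite mulr_gt0 ?exprn_gt0.
have e2 : eps ^+ (x2 (+) y) != 0 by rewrite expf_neq0 // gt_eqF.
have s0 : p.1 * eps ^+ (x1 (+) y) + p.2 * eps ^+ (x2 (+) y) != 0.
  by rewrite gt_eqF // addr_gt0.
by field; rewrite e2 s0 !gt_eqF.
Qed.

Lemma weights_after_update (R : realType) (eps : R) (t : nat) (p : R * R)
    (x1 x2 y : bool) : 0 < eps <= 1 -> weights_after eps t p ->
  weights_after eps t.+1 (mw_update eps p x1 x2 y).
Proof.
move=> /andP[e0 e1] hp; have := odds_update x1 x2 y e0 hp.
have r0 := odds_gt0 hp; case: hp => p1 p2 p12 hr.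
have w1 : 0 < p.1 * eps ^+ (x1 (+) y) by rewrite mulr_gt0 ?exprn_gt0.
have w2 : 0 < p.2 * eps ^+ (x2 (+) y) by rewrite mulr_gt0 ?exprn_gt0.
move=> hu; split.
- by rewrite divr_gt0 // addr_gt0.
- by rewrite divr_gt0 // addr_gt0.
- by rewrite /= -mulrDl divff // gt_eqF // addr_gt0.
- rewrite hu; apply: le_trans hr.
  have := exprn_gt0 t e0; move: (eps ^+ t) (exprS eps t) => et -> et0.
  have ret : 0 < odds p * et by rewrite mulr_gt0.
  set r := odds p in r0 ret *.
  (* The odds grow at most by the factor 1/eps, absorbed by the new factor [eps]. This is tight in
     the third case, where only expert 1 is right. *)
  case: (x1 (+) y); case: (x2 (+) y); rewrite !(expr0, expr1).
  + by rewrite mulfK ?gt_eqF //; nra.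
  + by rewrite divr1; have := mulr_ge0 (ltW e0) (ltW ret); nra.
  + by rewrite mulr1 -mulrA mulKf ?gt_eqF.
  + by rewrite mulr1 divr1; nra.
Qed.

(** * Loss and potential in one round *)

(* The loss of a round plus the potential after it; [c] tells whether expert 2
   is right. *)
Definition step_gain (R : realType) (mu eps : R) (M : nat) (a : action)
    (p : R * R) (c : bool) : R :=
  match a, c with
  | Lie, true => p.1 + potential mu eps M (odds p * eps)
  | Lie, false => 1 + potential mu eps M (odds p)
  | Truth, true => potential mu eps M (odds p)
  | Truth, false => p.2 + potential mu eps M (odds p / eps)
  end.

(** The loss is the total weight of the experts that err, so the outcome matters only through
    [x2 == y]. The odds are unchanged when both experts are right or both wrong. *)
Lemma step_gainE (R : realType) (mu eps : R) (M t : nat) (a : action)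
    (p : R * R) (y x2 : bool) : 0 < eps -> weights_after eps t p ->
  loss (forecast p (predict1 a y) x2) y
    + potential mu eps M (odds (mw_update eps p (predict1 a y) x2 y))
  = step_gain mu eps M a p (x2 == y).
Proof.
move=> e0 hp; rewrite (odds_update _ _ _ e0 hp).
case: hp => p1 p2 p12 _; have eK : eps / eps = 1 by rewrite divff // gt_eqF.
case: a; case: y; case: x2;
  rewrite /loss /forecast /= ?(mulr1, mulr0, addr0, add0r, expr0, expr1, divr1,
    subrr, normr0, subr0, p12, normr1) // -?mulrA ?eK ?mulr1 //.
all: try by [rewrite gtr0_norm | rewrite add0r | congr (_ + _);
  rewrite ?sub0r ?normrN ?normr1 // -p12 ler0_norm; lra].
Qed.

Lemma step_gain_ge0 (R : realType) (mu eps : R) (M : nat) (a : action)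
    (p : R * R) (c : bool) : 0 <= p.1 -> 0 <= p.2 ->
  0 <= step_gain mu eps M a p c.
Proof.
by move=> p1 p2; case: a; case: c; rewrite /= ?addr_ge0 ?potential_ge0.
Qed.

Lemma step_gain_le (R : realType) (mu eps : R) (M t : nat) (a : action)
    (p : R * R) : 0 <= mu <= 1 -> 0 < eps -> weights_after eps t p ->
    odds p * eps ^+ M * mu <= 1 - mu ->
  mu * step_gain mu eps M a p true + (1 - mu) * step_gain mu eps M a p false
  <= potential mu eps M (odds p) + (1 - mu ^+ 2).
Proof.
move=> /andP[mu0 mu1] e0 hp hM; have r0 := odds_gt0 hp.
have p1E := odds_ratio hp.
case: hp => p1 p2 p12 _; case: a => /=.
(* Truth: with probability 1 - mu the loss is [p.2 <= 1] and the potential grows by at most [mu],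
   and (1 - mu)(1 + mu) = 1 - mu^2. *)
- have := potentialM mu eps M (odds p / eps).
  rewrite mulfVK ?gt_eqF // => ->.
  have := excess_ge0 mu (odds p / eps * eps ^+ M).
  have : excess mu (odds p / eps) <= mu.
    by apply: excess_le; rewrite ?divr_ge0 // ltW.
  rewrite expr2; nra.
(* Lie: against a correct expert 2 the potential drops by the excess, so that [p.1] counts for at
   most 1 - mu, and mu (1 - mu) + (1 - mu) = 1 - mu^2. The boundary term vanishes by [hM]. *)
- have := le_excess mu (odds p); rewrite p1E => ?.
  rewrite potentialM (excess_eq0 (r := odds p * eps ^+ M)) ?addr0 //; last first.
    by rewrite mulr_ge0 ?exprn_ge0 // ltW.
  rewrite expr2; nra.
Qed.

(** * Integration over an independent event *)

Lemma ge0_integral_mrestr (R : realType) (d : measure_display)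
    (T : measurableType d) (m : {measure set T -> \bar R}) (C : set T)
    (mC : measurable C) (f : T -> \bar R) : measurable_fun setT f ->
    (forall x, 0 <= f x)%E ->
  (\int[mrestr m mC]_x f x = \int[m]_(x in C) f x)%E.
Proof.
move=> mf f0; rewrite -(setUCr C) ge0_integral_setU //; last first.
- exact/disj_setPCl.
- by rewrite setUCr.
- exact: measurableC.
rewrite [X in (_ + X)%E](eq_measure_integral mzero); last first.
  move=> A mA AC; rewrite /= /mrestr.
  by rewrite (_ : A `&` C = set0) ?measure0 //; apply/disjoints_subset.
rewrite integral_measure_zero adde0; apply: eq_measure_integral => A mA AC.
by rewrite /= /mrestr setIidl.
Qed.

(** Independence says that [m] restricted to [C] and [m] scaled by [c] have the same image under
    [X]; both integrals are computed on that image. *)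
Lemma ge0_integral_indep (R : realType) (d : measure_display)
    (T : measurableType d) (m : {measure set T -> \bar R}) (C : set T) (c : R)
    (X : T -> R) : measurable C -> 0 <= c -> measurable_fun setT X ->
    (forall x, 0 <= X x) ->
    (forall B, measurable B ->
       m (X @^-1` B `&` C) = c%:E * m (X @^-1` B))%E ->
  (\int[m]_(x in C) (X x)%:E = c%:E * \int[m]_x (X x)%:E)%E.
Proof.
move=> mC c0 mX X0 indep.
have mXE : measurable_fun setT (EFin \o X) by exact/measurable_EFinP.
have mn : measurable_fun setT (fun x : R => `|x|%:E).
  apply/measurable_EFinP. exact: normr_measurable.
(* The absolute value makes the integrand nonnegative on all of [R], as the change of variables
   needs. *)
have nE (D : set T) (n : {measure set T -> \bar R}) :
    (\int[n]_(x in D) (X x)%:E = \int[n]_(x in D) (`|X x|)%:E)%E.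
  by apply: eq_integral => x _; rewrite ger0_norm.
rewrite -ge0_integral_mrestr //.
have -> : c%:E = ((NngNum c0)%:num)%:E by [].
rewrite -(ge0_integral_mscale m measurableT (NngNum c0)) //; last first.
  by move=> x _; rewrite lee_fin.
rewrite !nE.
have push (n : {measure set T -> \bar R}) :
    (\int[n]_x (`|X x|)%:E = \int[pushforward n X]_x `|x|%:E)%E.
  by rewrite (ge0_integral_pushforward mX).
rewrite !push.
apply: eq_measure_integral  => A mA _; exact: indep.
Qed.

(** * Measurability of functions of the history *)

Lemma measurable_bits (d : measure_display) (Om : measurableType d)
    (y x : {mfun Om >-> bool}) (D : bool -> bool -> set Om) :
    (forall b c, measurable (D b c)) ->
  measurable [set w | D (y w) (x w) w].
Proof.
move=> mD; rewrite (_ : [set w | _] =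
    \bigcup_(b in [set: bool]) \bigcup_(c in [set: bool])
      (y @^-1` [set b] `&` x @^-1` [set c] `&` D b c)); last first.
  apply/seteqP; split => w /=; first by exists (y w) => //; exists (x w).
  by move=> [b _] [c _] [[<- <-]].
apply: fin_bigcup_measurable => // b _; apply: fin_bigcup_measurable => // c _.
by apply: measurableI => //; apply: measurableI; exact: measurable_funPTI.
Qed.

(** The history is determined by finitely many measurable bits, so [H] may be any set and strategies
    need no regularity. *)
Lemma measurable_hist (R : realType) (d : measure_display)
    (Om : measurableType d) (eps : R) (y x2 : nat -> {mfun Om >-> bool})
    (a : strategy R) (rho : R) (t : nat) (H : set (history R)) :
  measurable (hist_before eps (fun s => y s) (fun s => x2 s) a rho t @^-1` H).
Proof.
elim: t H => [|t IH] H.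
  by rewrite [X in measurable X]preimage_cst; case: ifP => _.
pose step b c (h : history R) :=
  (rcons h.1 (Round h.2 (predict1 (a t h) b) c b),
   mw_update eps h.2 (predict1 (a t h) b) c b).
exact: (measurable_bits (y t) (x2 t) (fun b c => IH (step b c @^-1` H))).
Qed.

Lemma measurable_fun_hist (R : realType) (d : measure_display)
    (Om : measurableType d) (eps : R) (y x2 : nat -> {mfun Om >-> bool})
    (a : strategy R) (rho : R) (t : nat) (f : history R -> R) :
  measurable_fun setT
    (fun w => f (hist_before eps (fun s => y s) (fun s => x2 s) a rho t w)).
Proof. by move=> _ B _; rewrite setTI; exact: (measurable_hist eps y x2 a rho t (f @^-1` B)). Qed.

Lemma measurable_round_loss (R : realType) (d : measure_display)
    (Om : measurableType d) (eps : R) (y x2 : nat -> {mfun Om >-> bool})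
    (a : strategy R) (rho : R) (t : nat) :
  measurable_fun setT
    (round_loss eps (fun s => y s) (fun s => x2 s) a rho t).
Proof.
move=> _ B _; rewrite setTI.
pose l b c (h : history R) :=
  loss (forecast h.2 (predict1 (a t h) b) c) b.
exact: (measurable_bits (y t) (x2 t)
  (fun b c => measurable_hist eps y x2 a rho t (l b c @^-1` B))).
Qed.

Lemma measurable_correct (d : measure_display) (Om : measurableType d)
    (y x : {mfun Om >-> bool}) : measurable [set w | x w = y w].
Proof.
apply: (@measurable_bits d Om y x (fun b c => [set _ | c = b])) => b c.
have [->|/eqP cb] := eqVneq c b.
  by rewrite (_ : [set _ | _] = setT) // -subTset.
by rewrite (_ : [set _ | _] = set0) // -subset0.
Qed.

(** * Expected loss and potential along the game *)

Lemma hist_weights_after (R : realType) (Om : Type) (eps : R)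
    (y x2 : nat -> Om -> bool) (a : strategy R) (rho : R) (t : nat) (w : Om) :
    0 < eps <= 1 -> weights_after eps 0 (rho, 1 - rho) ->
  weights_after eps t (hist_before eps y x2 a rho t w).2.
Proof.
by move=> e01 h0; elim: t => [//|t IH]; exact: weights_after_update.
Qed.

(** Once it is fixed whether expert 2 is right, the integrand is a function of the history, so
    independence brings out the factors [mu] and [1 - mu], and the one-round inequality applies
    pointwise. *)
Lemma integral_round_loss_potential_le (R : realType) (d : measure_display)
    (Om : measurableType d) (mu eps : R) (y x2 : nat -> {mfun Om >-> bool})
    (a : strategy R) (rho : R) (P : probability Om R) (M t : nat) :
    let hist := hist_before eps (fun s => y s) (fun s => x2 s) a rho in
    let W t w := potential mu eps M (odds (hist t w).2) in
    0 <= mu <= 1 -> 0 < eps <= 1 -> weights_after eps 0 (rho, 1 - rho) ->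
    honest_expert mu eps y x2 a rho P ->
    (forall w, odds (hist t w).2 * eps ^+ M * mu <= 1 - mu) ->
  (\int[P]_w (round_loss eps (fun s => y s) (fun s => x2 s) a rho t w
              + W t.+1 w)%:E
   <= \int[P]_w (W t w)%:E + (1 - mu ^+ 2)%:E)%E.
Proof.
move=> hist W mu01 e01 rho0 honest hM; have /andP[mu0 mu1] := mu01.
have /andP[e0 e1] := e01.
have hw w : weights_after eps t (hist t w).2 by exact: hist_weights_after.
pose G c w := step_gain mu eps M (a t (hist t w)) (hist t w).2 c.
have G0 c w : 0 <= G c w.
  by case: (hw w) => p1 p2 _ _; apply: step_gain_ge0; exact: ltW.
have mG c : measurable_fun setT (G c).
  exact: (measurable_fun_hist eps y x2 a rho t
    (fun h => step_gain mu eps M (a t h) h.2 c)).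
have mW s : measurable_fun setT (W s).
  exact: (measurable_fun_hist eps y x2 a rho s
    (fun h => potential mu eps M (odds h.2))).
pose C := [set w | x2 t w = y t w].
have mC : measurable C by exact: measurable_correct.
have indepC c : (\int[P]_(w in C) (G c w)%:E = mu%:E * \int[P]_w (G c w)%:E)%E.
  apply: ge0_integral_indep => // B mB.
  have [PC] := honest t [set h | B (step_gain mu eps M (a t h) h.2 c)].
  by rewrite PC muleC.
(* Independence passes to the complement by subtraction of finite probabilities. *)
have indepCC c : (\int[P]_(w in ~` C) (G c w)%:E
    = (1 - mu)%:E * \int[P]_w (G c w)%:E)%E.
  apply: ge0_integral_indep => //; [exact: measurableC|lra|move=> B mB].
  have mGB : measurable (G c @^-1` B) by rewrite -[X in measurable X]setTI; exact: mG.
  have [PC] := honest t [set h | B (step_gain mu eps M (a t h) h.2 c)].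
  rewrite -/C PC -/hist -[_ @^-1` _]/(G c @^-1` B) => PBC.
  rewrite -setDE measureD //; last by rewrite ltey_eq fin_num_measure.
  pose q := P (G c @^-1` B).
  have qfin : q \is a fin_num by exact: fin_num_measure.
  transitivity (q - q * mu%:E)%E; first by congr (_ - _)%E; exact: PBC.
  by change ((q - q * mu%:E)%E = ((1 - mu)%:E * q)%E); rewrite EFinB muleBl // mul1e muleC.
have stepE w : round_loss eps (fun s => y s) (fun s => x2 s) a rho t w + W t.+1 w
    = G (x2 t w == y t w) w by exact: step_gainE.
under eq_integral do rewrite stepE.
rewrite -(setUCr C) ge0_integral_setU //; last 4 first.
- exact: measurableC.
- rewrite setUCr; apply/measurable_EFinP.
  rewrite [X in measurable_fun _ X](_ : _ = fun w =>
    round_loss eps (fun s => y s) (fun s => x2 s) a rho t w + W t.+1 w).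
    by apply: measurable_funD => //; exact: measurable_round_loss.
  by apply/funext => w; rewrite stepE.
- by move=> w _; rewrite lee_fin.
- exact/disj_setPCl.
rewrite (eq_integral (fun w => (G true w)%:E)); last first.
  by move=> w; rewrite inE => ->; rewrite eqxx.
rewrite [X in (_ + X)%E](eq_integral (fun w => (G false w)%:E)); last first.
  by move=> w; rewrite inE => /= /eqP/negbTE ->.
rewrite indepC indepCC setUCr.
have nmu0 : 0 <= 1 - mu by lra.
have mGE c : measurable_fun setT (fun w => (G c w)%:E) by apply/measurable_EFinP.
have GE0 c w : (0 <= (G c w)%:E)%E by rewrite lee_fin.
rewrite -!ge0_integralZl_EFin // -ge0_integralD //; last 4 first.
- by move=> w _; rewrite mule_ge0.
- by apply: measurable_funeM.
- by move=> w _; rewrite mule_ge0.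
- by apply: measurable_funeM.
(* The constant becomes an integral against [P], so that the integrands can be compared. *)
rewrite -[X in (_ <= _ + X)%E]mule1 -(@probability_setT _ _ _ P).
rewrite -(integral_cst P measurableT) -ge0_integralD //; last 3 first.
- by move=> w _; rewrite lee_fin potential_ge0.
- by apply/measurable_EFinP.
- by move=> w _; rewrite lee_fin; nra.
apply: ge0_le_integral => //.
- by move=> w _; rewrite adde_ge0 // mule_ge0.
- by apply: emeasurable_funD; apply: measurable_funeM.
- by apply/measurable_EFinP; apply: measurable_funD.
- move=> w _; rewrite -!EFinM -!EFinD lee_fin.
  exact: step_gain_le (hw w) (hM w).
Qed.

Lemma expected_total_loss_le (R : realType) (d : measure_display)
    (Om : measurableType d) (mu eps : R) (y x2 : nat -> {mfun Om >-> bool})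
    (a : strategy R) (rho : R) (P : probability Om R) (K N : nat) :
    0 <= mu <= 1 -> 0 < eps <= 1 -> weights_after eps 0 (rho, 1 - rho) ->
    honest_expert mu eps y x2 a rho P -> eps ^+ K * mu <= 1 - mu ->
  ('E_P[total_loss eps (fun s => y s) (fun s => x2 s) a rho N]
   <= (K%:R + N%:R * (1 - mu ^+ 2))%:E)%E.
Proof.
move=> mu01 e01 rho0 honest hK; have /andP[mu0 mu1] := mu01.
have /andP[e0 e1] := e01.
pose hist := hist_before eps (fun s => y s) (fun s => x2 s) a rho.
(* With [K + N] terms the boundary term vanishes up to round [N]: the odds are at most eps^-t, which
   leaves a factor of at most [eps ^+ K]. *)
pose W t w := potential mu eps (K + N) (odds (hist t w).2).
pose L := round_loss eps (fun s => y s) (fun s => x2 s) a rho.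
pose S := total_loss eps (fun s => y s) (fun s => x2 s) a rho.
have mL t : measurable_fun setT (L t) by exact: measurable_round_loss.
have L0 t w : 0 <= L t w by exact: normr_ge0.
have mS t : measurable_fun setT (S t) by apply: measurable_sum => i; exact: mL.
have S0 t w : 0 <= S t w by apply: sumr_ge0.
have mW t : measurable_fun setT (W t).
  exact: (measurable_fun_hist eps y x2 a rho t
    (fun h => potential mu eps (K + N) (odds h.2))).
have W0 t w : 0 <= W t w by exact: potential_ge0.
have odds_le t w : (t <= N)%N -> odds (hist t w).2 * eps ^+ (K + N) <= eps ^+ K.
  move=> tN; have h := hist_weights_after (fun s => y s) (fun s => x2 s) a t w e01 rho0.
  have r0 := odds_gt0 h; case: h => _ _ _ r1.
  rewrite exprD mulrCA ler_piMr ?exprn_ge0 ?(ltW e0) //.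
  apply: le_trans r1; rewrite ler_wpM2l ?(ltW r0) //.
  by rewrite ler_wiXn2l // ltW.
(* Each round adds at most 1 - mu^2 to the expected past loss plus potential, which starts at most
   at [K]. *)
have bound t : (t <= N)%N ->
    (\int[P]_w (S t w + W t w)%:E <= (K%:R + t%:R * (1 - mu ^+ 2))%:E)%E.
  elim: t => [_|t IH tN].
    (* The initial history is constant in the sample point, so [point] stands for any. *)
    rewrite mul0r addr0 (eq_integral (cst (W 0%N point)%:E)); last first.
      by move=> w _; rewrite /S /total_loss big_ord0 add0r.
    rewrite integral_cst // [X in (_ * X)%E](probability_setT P) mule1 lee_fin.
    apply: potential_le => //; first by rewrite ltW.
    - by case: rho0 => /= p1 p2 _ _; rewrite divr_ge0 // ltW.
    - case: rho0 => _ _ _; rewrite expr0 mulr1 => r1.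
      apply: le_trans hK; rewrite ler_wpM2r // ler_piMl //.
      by rewrite exprn_ge0 // ltW.
  have -> : (\int[P]_w (S t.+1 w + W t.+1 w)%:E
      = \int[P]_w (S t w)%:E + \int[P]_w (L t w + W t.+1 w)%:E)%E.
    rewrite -ge0_integralD //.
    - by apply: eq_integral => w _; rewrite -EFinD /S /total_loss big_ord_recr /= addrA.
    - by move=> w _; rewrite lee_fin.
    - by apply/measurable_EFinP.
    - by move=> w _; rewrite lee_fin addr_ge0.
    - by apply/measurable_EFinP; apply: measurable_funD.
  have step : (\int[P]_w (L t w + W t.+1 w)%:E
      <= \int[P]_w (W t w)%:E + (1 - mu ^+ 2)%:E)%E.
    apply: integral_round_loss_potential_le => // w.
    by apply: le_trans hK; rewrite ler_wpM2r // odds_le // ltnW.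
  apply: le_trans (leeD2l _ step) _.
  rewrite addeA -ge0_integralD //; last 4 first.
  - by move=> w _; rewrite lee_fin.
  - by apply/measurable_EFinP.
  - by move=> w _; rewrite lee_fin.
  - by apply/measurable_EFinP.
  apply: le_trans (leeD2r _ (IH (ltnW tN))) _.
  by rewrite -EFinD lee_fin -(natr1 t); lra.
(* The final potential is nonnegative and is dropped. *)
rewrite expectation.unlock; apply: le_trans (bound N (leqnn N)).
apply: ge0_le_integral => //.
- by move=> w _; rewrite lee_fin S0.
- by apply/measurable_EFinP; exact: mS.
- by apply/measurable_EFinP; apply: measurable_funD.
- by move=> w _; rewrite lee_fin lerDl.
Qed.

(** * Passage to the limit *)

Lemma limn_esup_le_of_affine_bound (R : realType) (u : nat -> \bar R) (c k : R) :
    0 <= c -> 0 <= k -> (forall N, u N <= (k + N%:R * c)%:E)%E ->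
  (limn_esup (fun N : nat => u N * (N%:R^-1)%:E) <= c%:E)%E.
Proof.
move=> c0 k0 hu; apply/lee_addgt0Pr => e e0.
(* For [N >= n] one has k < e N; the successor also excludes [N = 0]. *)
pose n := (Num.truncn (k / e)).+1.
apply: le_trans (_ : (ereal_sup
    ((fun N : nat => u N * (N%:R^-1)%:E) @` [set N | (n <= N)%N]) <= _)%E).
  apply: ereal_inf_lbound; exists [set N | (n <= N)%N] => //.
  exact: nbhs_infty_ge.
apply: ge_ereal_sup => _ [N /= nN <-].
have N0 : 0 < N%:R :> R by rewrite ltr0n; apply: leq_trans nN.
apply: le_trans (lee_wpmul2r _ (hu N)) _; first by rewrite lee_fin invr_ge0 ltW.
rewrite -EFinM -EFinD lee_fin ler_pdivrMr //.
have : k / e < N%:R by apply: lt_le_trans (truncnS_gt _) _; rewrite ler_nat.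
rewrite ltr_pdivrMr //; lra.
Qed.


Theorem mainTheorem1 (R : realType) (d : measure_display)
    (Om : measurableType d) (mu eps : R)
    (y x2 : nat -> {mfun Om >-> bool})
    (Pr : R -> strategy R -> probability Om R)
    (mu01 : 0 < mu < 1) (eps01 : 0 < eps < 1)
    (honest : forall (rho : R) (a : strategy R), 0 <= rho <= 1 ->
       honest_expert mu eps y x2 a rho (Pr rho a)) :
  (limn_esup (fun N : nat => value eps y x2 Pr N (1 / 2) * (N%:R^-1)%:E)
    <= (1 - mu ^+ 2)%:E)%E.
Proof.
have /andP[mu0 mu1] := mu01; have /andP[e0 e1] := eps01.
(* Powers of [eps] tend to 0. As [K] depends only on [mu] and [eps], it is the constant of a bound
   affine in [N]. *)
have [K hK] : exists K, eps ^+ K * mu <= 1 - mu.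
  have : `|eps| < 1 by rewrite gtr0_norm.
  move=> /cvg_expr /cvgrPdist_le /(_ (1 - mu)) [|K _ hK]; first by rewrite subr_gt0.
  exists K; have := hK K (leqnn K).
  rewrite sub0r normrN ger0_norm ?exprn_ge0 ?(ltW e0) // => hKK.
  by apply: le_trans hKK; rewrite ler_piMr ?exprn_ge0 // ltW.
apply: (@limn_esup_le_of_affine_bound _ _ _ K%:R) => // [|N].
  rewrite expr2; nra.
apply: ge_ereal_sup => _ [a _ <-].
apply: expected_total_loss_le => //; try lra.
(* The initial weight 1/2 gives odds 1. *)
- split => /=; try lra.
  rewrite /odds /= expr0 mulr1 ler_pdivrMr; lra.
- apply: honest; lra.
Qed.
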